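(* Under hypotheses (H1), (H2), (H3) of the context, every solution $(\boldsymbol u_h,\varrho_h,\varsigma_h,\beta_h)$ of the semi-discrete scheme (S) of the context preserves the total entropy: $\int_\Omega\varsigma_h$ is constant in time.
   Context: Setting. $\Omega\subset\mathbb{R}^n$ ($n=2,3$) is a domain with boundary $\partial\Omega$ regular enough for Stokes' theorem; $X(\Omega)$ is the set of vector fields on $\Omega$ tangent to $\partial\Omega$. $d$ is the exterior derivative, $\star$ the Hodge operator, $i_{\boldsymbol u}$ the interior product with a vector field $\boldsymbol u$. $e=e(\rho,s)$ is a given smooth function (internal energy), with partial derivatives $\partial_\rho e$, $\partial_s e$. An $n$-form $\varrho=\rho\,dV$ is identified with its scalar density $\rho$ whenever it is an argument of $e$ or multiplies another $n$-form or a vector field inside an integrand; e.g. $\int_\Omega(\varrho\boldsymbol u)\cdot\boldsymbol v=\int_\Omega\rho\,\boldsymbol u\cdot\boldsymbol v\,dV$. (H1) $V_h^0,\dots,V_h^n$ are finite-dimensional spaces, $V_h^i$ consisting of $i$-forms on $\Omega$ on which $d$ is well defined, with $d(V_h^i)\subset V_h^{i+1}$. (H2) There are linear projection operators $\Pi^i$ onto $V_h^i$, $0\le i\le n$ (with domain containing all the forms to which they are applied below), which preserve the vanishing of forms at the boundary: if $\alpha$ has vanishing trace (pullback) on $\partial\Omega$, so does $\Pi^i\alpha$. $X_h\subset X(\Omega)$ is a finite-dimensional vector space of discrete vector fields. Let $$\mathfrak g_h=\{(A^0,\dots,A^n)\in L(V_h^0)\times\cdots\times L(V_h^n):\ dA^{i-1}=A^i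 d\},$$ with $L(V)$ the linear endomorphisms of $V$, and bracket $[A,B]^i=A^iB^i-B^iA^i$. For $\boldsymbol u_h\in X_h$, $A_{\boldsymbol u_h}=(A^0_{\boldsymbol u_h},\dots,A^n_{\boldsymbol u_h})\in\mathfrak g_h$ is defined by $$A^i_{\boldsymbol u_h}\alpha_h=d\,\Pi^{i-1}(i_{\boldsymbol u_h}\alpha_h)+\Pi^i(i_{\boldsymbol u_h}d\alpha_h),\qquad \alpha_h\in V_h^i,$$ (the first term is $0$ for $i=0$, the second is $0$ for $i=n$). (H3) The map $\boldsymbol u_h\mapsto A_{\boldsymbol u_h}$ from $X_h$ to $\mathfrak g_h$ is injective and a linear left inverse $\hat{\cdot}:\mathfrak g_h\to X_h$ is fixed: $\widehat{A_{\boldsymbol u_h}}=\boldsymbol u_h$ for all $\boldsymbol u_h\in X_h$. Semi-discrete scheme (S): find (smooth in time) curves $\boldsymbol u_h(t)\in X_h$, $\varrho_h(t),\varsigma_h(t)\in V_h^n$, $\beta_h(t)\in V_h^{n-1}$ such that $$ \int_\Omega \partial_t(\varrho_h\boldsymbol{u}_h)\cdot\boldsymbol{v}_h-(\varrho_h\boldsymbol{u}_h)\cdot\widehat{[A_{\boldsymbol{v}_h},A_{\boldsymbol{u}_h}]}+\Big(\tfrac12|\boldsymbol{u}_h|^2-e(\varrho_h,\varsigma_h)-\varrho_h\partial_{\varrho_h}e(\varrho_h,\varsigma_h)\Big)A^n_{\boldsymbol{v}_h}\varrho_h-\varrho_h\partial_{\varsigma_h}e(\varrho_h,\varsigma_h)A^n_{\boldsymbol{v}_h}\varsigma_h-\beta_h\wedge\star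 A^{n-1}_{\boldsymbol{v}_h}\beta_h=0\quad\forall\,\boldsymbol v_h\in X_h, $$ $$ \partial_t\varrho_h+A^n_{\boldsymbol u_h}\varrho_h=0,\qquad \partial_t\varsigma_h+A^n_{\boldsymbol u_h}\varsigma_h=0,\qquad \partial_t\beta_h+A^{n-1}_{\boldsymbol u_h}\beta_h=0 . $$ *)

(* Defs.v *)
From HB Require Import structures.
From mathcomp Require Import all_boot all_order all_algebra.
From mathcomp Require Import all_classical all_reals all_analysis.
Set Implicit Arguments. Unset Strict Implicit. Unset Printing Implicit Defensive.
Import Order.TTheory GRing.Theory Num.Theory numFieldNormedType.Exports.
Local Open Scope classical_set_scope.
Local Open Scope ring_scope.

(* R^n is 'rV[R]_n, with its Borel sigma-algebra; Lebesgue measure is built by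
   iterated products. *)

Section borel.
Variables (R : realType) (n : nat).
Let B := <<s (@open 'rV[R]_n) >>.
Let B0 : B set0. Proof. exact: sigma_algebra0. Qed.
Let BC A : B A -> B (~` A). Proof. exact: sigma_algebraC. Qed.
Let BU (F : _^nat) : (forall i, B (F i)) -> B (\bigcup_i F i).
Proof. exact: sigma_algebra_bigcup. Qed.
HB.instance Definition _ :=
  @isMeasurable.Build default_measure_display 'rV[R]_n B B0 BC BU.
End borel.

Lemma open_measurable_rV (R : realType) n (A : set 'rV[R]_n) :
  open A -> measurable A.
Proof. exact: sub_sigma_algebra. Qed.

Definition row_of (R : realType) n (t : n.-tuple (measurableTypeR R)) :
  'rV[R]_n := \row_i tnth t i.

Lemma measurable_row_of (R : realType) n : measurable_fun setT (@row_of R n).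
Proof.
apply: (@measurability _ _ _ _ setT (@row_of R n) open) => //.
move=> _ [U oU <-]; rewrite setTI.
pose box (p : 'rV[rat]_n * nat) : set 'rV[R]_n :=
  [set x | forall i, `|ratr (p.1 0 i) - x 0 i| < p.2.+1%:R^-1].
have -> : @row_of R n @^-1` U =
   \bigcup_(p in [set p | box p `<=` U]) (@row_of R n @^-1` box p).
  apply/seteqP; split=> t /=; last by case=> p /= + tp; apply.
  move=> Ut; have /nbhs_ballP[e /= e0 eU] := open_nbhs_nbhs (conj oU Ut).
  pose k := Num.truncn (2 / e).
  have ke : (k.+1%:R : R)^-1 < e / 2.
    rewrite -[ltRHS]invrK ltf_pV2 ?posrE ?invr_gt0 ?divr_gt0//.
    by rewrite invf_div truncnS_gt.
  have rat_near (x : R) : {q : rat | `|ratr q - x| < k.+1%:R^-1}.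
    apply/cid.
    have [|q] := @rat_in_itvoo _ (x - k.+1%:R^-1) (x + k.+1%:R^-1).
      by rewrite ltrBlDr -addrA ltrDl addr_gt0// invr_gt0.
    by rewrite in_itv/= => /andP[h1 h2]; exists q; rewrite ltr_distl h1.
  exists (\row_i sval (rat_near (tnth t i)), k).
    move=> x /= bx; apply: eU; split=> [|i j].
      exact: e0.
    rewrite ord1 /ball_ /ball/= !mxE.
    have := bx j; rewrite mxE; case: (rat_near _) => q /= qt qx.
    rewrite -(subrKA (ratr q)) [ltRHS]splitr (le_lt_trans (ler_normD _ _))//.
    by rewrite ltrD// (lt_trans _ ke)// distrC.
  by move=> i /=; rewrite !mxE; case: (rat_near _).
rewrite bigcup_mkcond; apply: countable_bigcupT_measurable => //= p.
case: ifP => // _.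
have -> : @row_of R n @^-1` box p =
    \big[setI/setT]_(i < n) [set t | `|ratr (p.1 0 i) - tnth t i| < p.2.+1%:R^-1].
  rewrite -bigcap_seq.
  apply/seteqP; split=> t /=.
    by move=> bt i _ /=; have := bt i; rewrite mxE.
  move=> bt i; rewrite mxE; apply: bt => /=; exact: mem_index_enum.
apply: bigsetI_measurable => i _.
have -> : [set t : n.-tuple (measurableTypeR R) | `|ratr (p.1 0 i) - tnth t i| < p.2.+1%:R^-1] =
   setT `&` (fun t => tnth t i) @^-1` (ball (ratr (p.1 0 i) : R) p.2.+1%:R^-1).
  by rewrite setTI.
apply: measurable_tnth => //.
rewrite ball_itv; exact: measurable_itv.
Qed.

Section lebesgue_tuple.
Variable R : realType.
Local Notation Rt := (measurableTypeR R).

Definition cons_tuple n (p : Rt * n.-tuple Rt) : n.+1.-tuple Rt :=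
  [tuple of p.1 :: p.2].

Lemma measurable_cons_tuple n : measurable_fun setT (@cons_tuple n).
Proof. exact: (@measurable_cons _ _ _ _ fst _ snd). Qed.



Section lebesgue_step.
Local Open Scope ereal_scope.
Variables (n : nat) (m : {sigma_finite_measure set (n.-tuple Rt) -> \bar R}).

Definition lebesgue_cons : set (n.+1.-tuple Rt) -> \bar R :=
  pushforward (lebesgue_measure \x m) (@cons_tuple n).

Let mcons := @measurable_cons_tuple n.

Let lebesgue_cons0 : lebesgue_cons set0 = 0.
Proof. by apply: measure0; exact: mcons. Qed.

Let lebesgue_cons_ge0 A : 0 <= lebesgue_cons A.
Proof. by apply: measure_ge0; exact: mcons. Qed.

Let lebesgue_cons_sigma_additive : semi_sigma_additive lebesgue_cons.
Proof. by apply: measure_semi_sigma_additive; exact: mcons. Qed.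

HB.instance Definition _ := isMeasure.Build _ _ _ lebesgue_cons
  lebesgue_cons0 lebesgue_cons_ge0 lebesgue_cons_sigma_additive.

Let lebesgue_cons_sigma_finite : sigma_finite setT lebesgue_cons.
Proof.
have /sigma_finiteP[F [TF ndF Foo]] := sigma_finiteT (@lebesgue_measure R).
have /sigma_finiteP[G [TG ndG Goo]] := sigma_finiteT m.
exists (fun k => [set t | F k (thead t) /\ G k [tuple of behead t]]).
  apply/seteqP; split=> // t _.
  have [i _ Fi] : (\bigcup_i F i) (thead t) by rewrite -TF.
  have [j _ Gj] : (\bigcup_i G i) [tuple of behead t] by rewrite -TG.
  exists (maxn i j) => //; split.
    by move: Fi; exact/subsetPset/ndF/leq_maxl.
  by move: Gj; exact/subsetPset/ndG/leq_maxr.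
move=> k; have [mF Fk] := Foo k; have [mG Gk] := Goo k; split.
  apply: measurableI; rewrite -[X in measurable X]setTI.
    exact: (measurable_tnth ord0).
  exact: measurable_behead.
rewrite /lebesgue_cons /pushforward.
suff -> : @cons_tuple n @^-1`
    [set t | F k (thead t) /\ G k [tuple of behead t]] = F k `*` G k.
  by rewrite product_measure1E// lte_mul_pinfty// ge0_fin_numE.
apply/seteqP; split=> -[x t] /=; rewrite /thead (tnth_nth x)/=.
  by move=> [Fx]; rewrite (_ : [tuple of _] = t)//; exact: val_inj.
by move=> [Fx Gt]; split => //; rewrite (_ : [tuple of _] = t)//; exact: val_inj.
Qed.

HB.instance Definition _ := Measure_isSigmaFinite.Build _ _ _ lebesgue_cons
  lebesgue_cons_sigma_finite.

End lebesgue_step.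

Fixpoint lebesgue_tuple n : {sigma_finite_measure set (n.-tuple Rt) -> \bar R} :=
  if n is k.+1 then lebesgue_cons (lebesgue_tuple k) else \d_ [tuple].

End lebesgue_tuple.

Section lebesgue_rV.
Local Open Scope ereal_scope.
Variables (R : realType) (n : nat).
Definition lebesgue_rV : set 'rV[R]_n -> \bar R :=
  pushforward (lebesgue_tuple R n) (@row_of R n).

Let mrow := @measurable_row_of R n.

Let lebesgue_rV0 : lebesgue_rV set0 = 0.
Proof. by apply: measure0; exact: mrow. Qed.

Let lebesgue_rV_ge0 A : 0 <= lebesgue_rV A.
Proof. by apply: measure_ge0; exact: mrow. Qed.

Let lebesgue_rV_sigma_additive : semi_sigma_additive lebesgue_rV.
Proof. by apply: measure_semi_sigma_additive; exact: mrow. Qed.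

HB.instance Definition _ := isMeasure.Build _ _ _ lebesgue_rV
  lebesgue_rV0 lebesgue_rV_ge0 lebesgue_rV_sigma_additive.

End lebesgue_rV.

Arguments lebesgue_rV : clear implicits.

(* The exterior algebra of R^n, in the basis dx^I (I a subset of 'I_n, the
   factors of dx^I in increasing order): a I is the coefficient of dx^I.
   Forms of all degrees live in one type; homogeneous i singles out degree i.
   There is no nonzero homogeneous element of degree > n, so that below every
   family of spaces of i-forms may be indexed by all i : nat. *)
Notation ext R n := {ffun {set 'I_n} -> R^o}.
Notation form R n := ('rV[R]_n -> {ffun {set 'I_n} -> R^o}).
Notation vfield R n := ('rV[R]_n -> 'rV[R]_n).

Section exterior_algebra.
Variables (R : realType) (n : nat).
Implicit Types (a b : ext R n) (u v : 'rV[R]_n) (I K : {set 'I_n}).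

Definition dotp u v : R := \sum_i u 0 i * v 0 i.

(* dx^I /\ dx^J = shuffle_sign I J dx^(I u J) when I and J are disjoint. *)
Definition shuffle_sign I K : R :=
  (-1) ^+ #|[pred p : 'I_n * 'I_n | [&& p.1 \in I, p.2 \in K & (p.2 < p.1)%N]]|.

Definition homogeneous (i : nat) a := forall I, #|I| != i -> a I = 0.

Definition wedge a b : ext R n :=
  [ffun K : {set 'I_n} =>
     \sum_(I in powerset K) shuffle_sign I (K :\: I)%SET * a I * b (K :\: I)%SET].

(* star (dx^I) = shuffle_sign I (~: I) dx^(~: I) *)
Definition star a : ext R n :=
  [ffun K : {set 'I_n} => shuffle_sign (~: K)%SET K * a (~: K)%SET].

Definition covector v : ext R n :=
  [ffun K : {set 'I_n} => \sum_(i | K == [set i]%SET) v 0 i].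

Definition interior_prod u a : ext R n :=
  [ffun K : {set 'I_n} =>
     \sum_(i | i \notin K) shuffle_sign [set i]%SET K * u 0 i * a (i |: K)%SET].

(* a(v_1, ..., v_k) = i_(v_k) ... i_(v_1) a for a of degree k *)
Definition eval_ext a (vs : seq 'rV[R]_n) : R :=
  foldl (fun b v => interior_prod v b) a vs finset.set0.

(* The scalar density rho of an n-form rho dV. *)
Definition density a : R := a [set: 'I_n]%SET.

End exterior_algebra.

Section smoothness.
Variables (R : realType) (V W : normedModType R).

Definition iter_derive (vs : seq V) (f : V -> W) : V -> W :=
  foldr (fun v (g : V -> W) x => 'D_v g x) f vs.

Definition smooth_on (D : set V) (f : V -> W) :=
  forall vs x, D x -> {for x, continuous (iter_derive vs f)} /\
    forall v, derivable (iter_derive vs f) x v.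

End smoothness.

Section forms.
Variables (R : realType) (n : nat).
Implicit Types (Omega : set 'rV[R]_n) (alpha beta : form R n) (u : vfield R n).

Local Notation mu := (lebesgue_rV R n).

Definition boundary Omega := closure Omega `\` Omega^°.

Definition grad (f : 'rV[R]_n -> R) : vfield R n :=
  fun x => \row_i 'D_(delta_mx 0 i) (f : 'rV[R]_n -> R^o) x.

Definition test_function Omega (f : 'rV[R]_n -> R) :=
  smooth_on setT (f : 'rV[R]_n -> R^o) /\
  exists2 K, compact K /\ K `<=` Omega & forall x, ~ K x -> f x = 0.

(* beta = d alpha in the weak sense, i.e. int f beta = - int df /\ alpha,
   coefficient by coefficient, for all test functions f; this is the classical
   d alpha = sum_i dx^i /\ (d alpha / dx^i) when alpha is C^1, and it also
   covers the piecewise smooth conforming forms of finite element spaces. *)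
Definition is_extd Omega alpha beta := forall f, test_function Omega f ->
  forall I, Rintegral mu Omega
    (fun x => f x * beta x I + wedge (covector (grad f x)) (alpha x) I) = 0.

Definition intp u alpha : form R n := fun x => interior_prod (u x) (alpha x).

(* i-forms on Omega which are integrable on Omega and bounded near every
   boundary point.  Without the latter, traces defined almost everywhere on the
   boundary do not determine the boundary term of Stokes' theorem: in the half
   plane y > 0 the form (x dy - y dx) / (x^2 + y^2), cut off at infinity, has
   trace 0 away from the origin, but a nonzero boundary contribution there. *)
Record admissible_form Omega (i : nat) alpha : Prop := {
  admissible_degree : forall x, Omega x -> homogeneous i (alpha x);
  admissible_integrable :
    forall I, mu.-integrable Omega (EFin \o (fun x => alpha x I));
  admissible_bounded : forall x I, boundary Omega x ->
    bounded_near (fun y => alpha y I) (within Omega (nbhs x)) }.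

Definition integral_form Omega alpha : R :=
  Rintegral mu Omega (fun x => density (alpha x)).

End forms.

(* The boundary is described by its surface measure sigma and by an orthonormal
   frame E(x) at sigma-almost every boundary point x: the first row of E x is
   the outward unit normal nu, the other rows form a positively oriented
   orthonormal basis of the tangent space nu^perp. *)
Section boundary.
Variables (R : realType) (n : nat) (Omega : set 'rV[R]_n).
Variables (sigma : {measure set 'rV[R]_n -> \bar R}) (E : 'rV[R]_n -> 'M[R]_n).
Implicit Types (alpha beta : form R n) (u : vfield R n) (x v : 'rV[R]_n).

Local Notation dOmega := (boundary Omega).

Definition frame_rows x : seq 'rV[R]_n := [seq row i (E x) | i <- enum 'I_n].

Definition normal x : 'rV[R]_n := head 0 (frame_rows x).

Definition tangent_frame x : seq 'rV[R]_n := behead (frame_rows x).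

Definition tangent_at x v := dotp v (normal x) = 0.

(* The trace (pullback to the boundary) of alpha at x, as a function of
   tangent vectors, is the boundary value of the tangential components of
   alpha. *)
Definition trace alpha x (vs : seq 'rV[R]_n) : R :=
  lim ((eval_ext (alpha y) vs : R^o) @[y --> within Omega (nbhs x)]).

Definition has_trace (i : nat) alpha :=
  {ae sigma, forall x, dOmega x ->
    forall vs, size vs = i -> (forall v, v \in vs -> tangent_at x v) ->
    cvg ((eval_ext (alpha y) vs : R^o) @[y --> within Omega (nbhs x)])}.

Definition vanishing_trace (i : nat) alpha :=
  {ae sigma, forall x, dOmega x ->
    forall vs, size vs = i -> (forall v, v \in vs -> tangent_at x v) ->
    (eval_ext (alpha y) vs : R^o) @[y --> within Omega (nbhs x)] --> (0 : R^o)}.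

Definition tangent_field u :=
  {ae sigma, forall x, dOmega x ->
    (dotp (u y) (normal x) : R^o) @[y --> within Omega (nbhs x)] --> (0 : R^o)}.

(* g is (almost everywhere) the density, with respect to surface measure, of
   the trace of the (n-1)-form alpha; the integral of that trace over the
   oriented boundary is the sigma-integral of g. *)
Definition trace_density alpha (g : 'rV[R]_n -> R) :=
  {ae sigma, forall x, dOmega x -> g x = trace alpha x (tangent_frame x)}.

(* A domain whose boundary is regular enough for Stokes' theorem.  Applied to
   smooth compactly supported alpha, stokes says that nu sigma is minus the
   distributional gradient of the indicator function of Omega; hence sigma and
   nu are determined by Omega. *)
Record stokes_domain : Prop := {
  domain_open : open Omega;
  domain_connected : connected Omega;
  domain_neq0 : Omega !=set0;
  frame_measurable : forall i j, measurable_fun setT (fun x => E x i j);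
  frame_orthonormal : forall x, E x *m (E x)^T = 1%:M;
  frame_oriented : forall x, \det (E x) = 1;
  surface_supp : sigma (~` dOmega) = 0%E;
  surface_finite : forall K, compact K -> (sigma K < +oo)%E;
  stokes : forall alpha beta (g : 'rV[R]_n -> R),
    admissible_form Omega n.-1 alpha ->
    (forall x, Omega x -> homogeneous n (beta x)) ->
    (forall I, (lebesgue_rV R n).-integrable Omega
                 (EFin \o (fun x => beta x I))) ->
    is_extd Omega alpha beta ->
    has_trace n.-1 alpha -> trace_density alpha g ->
    sigma.-integrable dOmega (EFin \o g) ->
    integral_form Omega beta = Rintegral sigma dOmega g }.

End boundary.

(* The discrete spaces are abstract finite-dimensional spaces, realized as
   spaces of forms and vector fields by the linear maps form_of and field_of;
   extd is the exterior derivative between them, proj_form i the projection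
   onto i-forms with domain proj_dom i, and hat the left inverse of
   u |-> A_u. *)
Record discretization (R : realType) (n : nat) := Discretization {
  form_sp : nat -> vectType R;
  form_of : forall i, {linear form_sp i -> form R n};
  extd : forall i, 'Hom(form_sp i, form_sp i.+1);
  proj_dom : nat -> set (form R n);
  proj_form : forall i, form R n -> form_sp i;
  field_sp : vectType R;
  field_of : {linear field_sp -> vfield R n};
  hat : (forall i, 'End(form_sp i)) -> field_sp }.

Arguments hat {R n} d _ : rename.

Section discrete.
Variables (R : realType) (n : nat) (Omega : set 'rV[R]_n).
Variables (sigma : {measure set 'rV[R]_n -> \bar R}) (E : 'rV[R]_n -> 'M[R]_n).
Variable D : discretization R n.

Local Notation mu := (lebesgue_rV R n).
Local Notation V := (form_sp D).
Local Notation X := (field_sp D).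
Local Notation tuples := (forall i, 'End(V i)).

(* The spaces V_h^i of i-forms, modulo null sets; by forms_injective, extd is
   determined by forms_extd. *)
Record discrete_forms : Prop := {
  forms_admissible : forall i (a : V i), admissible_form Omega i (form_of D i a);
  forms_injective : forall i (a : V i),
    {ae mu, forall x, Omega x -> form_of D i a x = 0} -> a = 0;
  forms_extd : forall i (a : V i),
    is_extd Omega (form_of D i a) (form_of D i.+1 (extd D i a)) }.

Record discrete_projections : Prop := {
  proj_degree : forall i alpha, proj_dom D i alpha ->
    forall x, Omega x -> homogeneous i (alpha x);
  proj_dom_zero : forall i, proj_dom D i 0;
  proj_dom_lin : forall i c alpha beta,
    proj_dom D i alpha -> proj_dom D i beta ->
    proj_dom D i (c *: alpha + beta);
  proj_linear : forall i c alpha beta,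
    proj_dom D i alpha -> proj_dom D i beta ->
    proj_form D i (c *: alpha + beta) =
      c *: proj_form D i alpha + proj_form D i beta;
  proj_dom_form : forall i (a : V i), proj_dom D i (form_of D i a);
  proj_formK : forall i (a : V i), proj_form D i (form_of D i a) = a;
  proj_dom_intp : forall i (u : X) (a : V i.+1),
    proj_dom D i (intp (field_of D u) (form_of D i.+1 a));
  proj_trace : forall i alpha, proj_dom D i alpha ->
    vanishing_trace Omega sigma E i alpha ->
    vanishing_trace Omega sigma E i (form_of D i (proj_form D i alpha)) }.

(* X_h is a space of vector fields (modulo null sets) tangent to the
   boundary. *)
Record discrete_fields : Prop := {
  fields_tangent : forall u : X, tangent_field Omega sigma E (field_of D u);
  fields_injective : forall u : X,
    {ae mu, forall x, Omega x -> field_of D u x = 0} -> u = 0 }.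

Definition in_gh (A : tuples) :=
  forall i, (extd D i \o A i = A i.+1 \o extd D i)%VF.

Definition bracket (A B : tuples) : tuples :=
  fun i => (A i \o B i - B i \o A i)%VF.

Definition lie_fun (u : X) (i : nat) : V i -> V i :=
  match i return V i -> V i with
  | 0 => fun a =>
      proj_form D 0 (intp (field_of D u) (form_of D 1 (extd D 0 a)))
  | j.+1 => fun a =>
      extd D j (proj_form D j (intp (field_of D u) (form_of D j.+1 a))) +
      proj_form D j.+1
        (intp (field_of D u) (form_of D j.+2 (extd D j.+1 a)))
  end.

(* A_u; for i = n the second term of lie_fun is 0 since extd D n is 0.
   linfun turns lie_fun, which is linear when the projections are, into an
   element of 'End. *)
Definition lie (u : X) : tuples := fun i => linfun (lie_fun u (i := i)).

Record lie_left_inverse : Prop := {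
  lie_injective : injective lie;
  hat_linear : forall c (A B : tuples), in_gh A -> in_gh B ->
    hat D (fun i => c *: A i + B i) = c *: hat D A + hat D B;
  lieK : forall u, hat D (lie u) = u }.

(* Coordinates in a fixed basis of a finite-dimensional space; smoothness and
   the derivative of a curve do not depend on the basis. *)
Definition curve_coord (W : vectType R) (c : R -> W)
    (i : 'I_(\dim (fullv : {vspace W}))) (t : R) : R :=
  coord (vbasis fullv) i (c t).

Definition dtime (W : vectType R) (c : R -> W) (t : R) : W :=
  \sum_i derive1 (curve_coord c i : R -> R^o) t *: (vbasis fullv)`_i.

(* c is continuous on J and smooth in its interior; this includes curves on
   J = [0, T] or [0, T[ that are smooth up to the initial time. *)
Definition smooth_curve (W : vectType R) (J : set R) (c : R -> W) :=
  forall i, {within J, continuous (curve_coord c i)} /\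
    smooth_on (J^° : set R^o) (curve_coord c i : R^o -> R^o).

Section scheme.
(* e is defined and smooth on the open set De. *)
Variables (De : set (R^o * R^o)) (e : R^o * R^o -> R^o).
Variables (u : R -> X) (rho sig : R -> V n) (beta : R -> V n.-1).

Local Notation fld v := (field_of D v).
Local Notation dens a := (fun x => density (form_of D n a x)).

Definition momentum_integrand (t : R) (v : X) (x : 'rV[R]_n) : R :=
  let r := dens (rho t) x in
  let s := dens (sig t) x in
  let de_rho := 'D_(1, 0) e (r, s) in
  let de_sig := 'D_(0, 1) e (r, s) in
  let ux := fld (u t) x in
  dotp (derive1 (fun t' => dens (rho t') x *: fld (u t') x) t) (fld v x)
  - dotp (r *: ux) (fld (hat D (bracket (lie v) (lie (u t)))) x)
  + (2^-1 * dotp ux ux - e (r, s) - r * de_rho) * dens (lie v n (rho t)) x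
  - r * de_sig * dens (lie v n (sig t)) x
  - density (wedge (form_of D n.-1 (beta t) x)
                   (star (form_of D n.-1 (lie v n.-1 (beta t)) x))).

Record scheme_solution (J : set R) : Prop := {
  smooth_u : smooth_curve J u;
  smooth_rho : smooth_curve J rho;
  smooth_sig : smooth_curve J sig;
  smooth_beta : smooth_curve J beta;
  state_in_De : forall t, J^° t ->
    {ae mu, forall x, Omega x -> De (dens (rho t) x, dens (sig t) x)};
  momentum_integrable : forall t, J^° t -> forall v : X,
    mu.-integrable Omega (EFin \o momentum_integrand t v);
  momentum : forall t, J^° t -> forall v : X,
    Rintegral mu Omega (momentum_integrand t v) = 0;
  transport_rho : forall t, J^° t ->
    dtime rho t + lie (u t) n (rho t) = 0;
  transport_sig : forall t, J^° t ->
    dtime sig t + lie (u t) n (sig t) = 0;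
  transport_beta : forall t, J^° t ->
    dtime beta t + lie (u t) n.-1 (beta t) = 0 }.

End scheme.
End discrete.

(* Main.v *)
Require Import Defs.
From HB Require Import structures.
From mathcomp Require Import all_boot all_order all_algebra.
From mathcomp Require Import all_classical all_reals all_analysis.
From mathcomp Require Import ring.
Import Order.TTheory GRing.Theory Num.Theory numFieldNormedType.Exports.
Local Open Scope classical_set_scope.
Local Open Scope ring_scope.

(** The entropy form [sig] satisfies [d sig / dt = - A_u sig]. There are no
    (n+1)-forms, so on n-forms [A_u a = d Pi (i_u a)], and by Stokes' theorem the
    integral of [A_u a] is a boundary integral of the trace of [Pi (i_u a)]. This
    trace vanishes. Indeed, let [nu] be the unit normal. As [nu /\ a = 0], the
    antiderivation identity [i_v (nu /\ a) + nu /\ i_v a = (v . nu) a]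
    ([interior_covector_wedge]) gives [nu /\ i_u a = (u . nu) a], and contracting
    with tangent vectors [vs] shows that [(i_u a)(vs)] is [u . nu] times a
    combination of coefficients of [a] contracted with [vs] ([eval_ext_normal]).
    The first factor tends to 0 at the boundary since [u] is tangent, the second
    one is bounded, hence [i_u a] has vanishing trace ([vanishing_trace_intp]),
    which [Pi] preserves. So the integral of [A_u a] is 0 ([integral_lie]).

    The integral is a linear functional on the finite-dimensional space of
    discrete n-forms; along the curve [sig] its time derivative is therefore 0
    in the interior of the time interval, and it is continuous up to the end
    points, hence constant ([linear_curve_cst]). *)

Set Implicit Arguments.
Unset Strict Implicit.

(** * Interior and exterior products *)

Section ext_product.
Variables (R : realType) (n : nat).
Implicit Types (a b : ext R n) (u v w : 'rV[R]_n) (I K : {set 'I_n}).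

(** The left exterior product of [a] with the 1-form [sum_j w_j dx^j], in the
    basis [dx^K]. *)
Definition covector_wedge w a : ext R n :=
  [ffun K : {set 'I_n} =>
     \sum_(j in K) shuffle_sign R [set j]%SET (K :\ j)%SET * w 0 j * a (K :\ j)%SET].

(** The number of elements of [K] below [i], whose parity gives the sign of
    [dx^i /\ dx^K] in the basis, for [i] outside [K]. *)
Definition rank_in (i : 'I_n) K := #|[pred k in K | (k < i)%N]|.

Lemma shuffle_sign1 i K : shuffle_sign R [set i]%SET K = (-1) ^+ rank_in i K.
Proof.
rewrite /shuffle_sign /rank_in; congr (_ ^+ _).
rewrite -(card_in_imset (f := fun k => (i, k)) (D := [pred k in K | (k < i)%N])).
  apply: eq_card => -[p q]; rewrite !inE /=; apply/idP/imsetP => [/and3P[/eqP-> qK qi]|].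
    by exists q => //; rewrite inE qK.
  by move=> [k]; rewrite inE => /andP[kK ki] [-> ->]; rewrite eqxx kK.
by move=> k l _ _ [].
Qed.

Lemma shuffle_sign1_sqr i K :
  shuffle_sign R [set i]%SET K * shuffle_sign R [set i]%SET K = 1.
Proof. by rewrite shuffle_sign1 -expr2 sqrr_sign. Qed.

Lemma rank_inD1 i j K : j \in K -> rank_in i K = ((j < i) + rank_in i (K :\ j)%SET)%N.
Proof.
move=> jK; rewrite /rank_in (cardD1 j) inE jK /=; congr (_ + _)%N.
by apply: eq_card => k; rewrite !inE; case: (k == j).
Qed.

(** Moving [dx^j] out of [dx^i /\ dx^K] and moving [dx^i] in gives opposite
    signs in the two possible orders, when [i] is outside [K] and [j] in [K]; this is what makes the mixed terms of the
    antiderivation identity below cancel. *)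
Lemma shuffle_sign1_swap i j K : i \notin K -> j \in K ->
  shuffle_sign R [set i]%SET K * shuffle_sign R [set j]%SET ((i |: K) :\ j)%SET =
  - (shuffle_sign R [set j]%SET (K :\ j)%SET * shuffle_sign R [set i]%SET (K :\ j)%SET).
Proof.
move=> iK jK; have ij : i != j by apply: contraNneq iK => ->.
have iKj : i \in ((i |: K) :\ j)%SET by rewrite !inE eqxx ij.
have E : (((i |: K) :\ j) :\ i = K :\ j)%SET.
  apply/setP => k; rewrite !inE; case: (eqVneq k i) => [->|] //=.
  by rewrite (negbTE iK) andbF.
rewrite !shuffle_sign1 (rank_inD1 i jK) (rank_inD1 j iKj) E !exprD.
have : (-1 : R) ^+ (j < i)%N * (-1) ^+ (i < j)%N = -1.
  by move: ij; rewrite -val_eqE /=; case: ltngtP => //= _ _; rewrite ?mul1r ?mulr1.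
move=> Es; rewrite mulrACA Es mulN1r mulrC //.
Qed.

(** The antiderivation identity [i_v (w /\ a) + w /\ i_v a = (v . w) a]. *)
Lemma interior_covector_wedge v w a :
  interior_prod v (covector_wedge w a) + covector_wedge w (interior_prod v a) =
  dotp v w *: a.
Proof.
apply/ffunP => K; rewrite !ffunE.
(* The common value, up to sign, of the mixed terms, with i outside K and j in
   K, of the two double sums; the diagonal terms i = j add up to (v . w) a. *)
pose X i j := shuffle_sign R [set j]%SET (K :\ j)%SET * w 0 j *
  (shuffle_sign R [set i]%SET (K :\ j)%SET * v 0 i * a (i |: (K :\ j))%SET).
have -> : \sum_(i | i \notin K) shuffle_sign R [set i]%SET K * v 0 i *
     covector_wedge w a (i |: K)%SET =
   \sum_(i | i \notin K) (v 0 i * w 0 i * a K - \sum_(j in K) X i j).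
  apply: eq_bigr => i iK; rewrite ffunE big_setU1//= mulrDr; congr (_ + _).
    rewrite finset.setU1K// [X in X = _](_ : _ = (shuffle_sign R [set i]%SET K *
      shuffle_sign R [set i]%SET K) * (v 0 i * w 0 i * a K)).
      by rewrite shuffle_sign1_sqr mul1r.
    by rewrite -!mulrA; congr (_ * _); rewrite mulrCA; congr (_ * _); rewrite mulrCA.
  rewrite mulr_sumr -sumrN; apply: eq_bigr => j jK.
  have ij : i != j by apply: contraNneq iK => ->.
  have -> : ((i |: K) :\ j = i |: (K :\ j))%SET.
    by apply/setP => k; rewrite !inE; case: (eqVneq k i) => [->|]; rewrite ?ij.
  have := shuffle_sign1_swap iK jK.
  have -> : ((i |: K) :\ j = i |: (K :\ j))%SET.
    by apply/setP => k; rewrite !inE; case: (eqVneq k i) => [->|]; rewrite ?ij.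
  rewrite /X; set s1 := shuffle_sign _ _ _; set s2 := shuffle_sign _ _ _.
  set s3 := shuffle_sign _ _ _; set s4 := shuffle_sign _ _ _ => ss.
  move: (v 0 i) (w 0 j) (a _) => x y z.
  transitivity ((s1 * s2) * (x * y * z)); first by ring.
  rewrite ss; ring.
rewrite big_split /= sumrN.
have -> : \sum_(j in K) shuffle_sign R [set j]%SET (K :\ j)%SET * w 0 j *
     interior_prod v a (K :\ j)%SET =
   \sum_(j in K) (v 0 j * w 0 j * a K + \sum_(i | i \notin K) X i j).
  apply: eq_bigr => j jK; rewrite ffunE (bigD1 j) /=; last by rewrite !inE eqxx.
  rewrite mulrDr finset.setD1K//; congr (_ + _).
    have := shuffle_sign1_sqr j (K :\ j)%SET; set s := shuffle_sign _ _ _ => ss.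
    move: (v 0 j) (w 0 j) (a _) => x y z.
    transitivity ((s * s) * (x * y * z)); first by ring.
    by rewrite ss mul1r.
  rewrite mulr_sumr; apply: eq_bigl => i; rewrite !inE negb_and negbK.
  by case: (eqVneq i j) => [->|]; rewrite ?jK ?andbT.
rewrite big_split /= [X in _ - X]exchange_big /= addrACA addNr addr0.
rewrite /dotp /GRing.scale /= mulr_suml.
rewrite [RHS](bigID (fun i => i \notin K)) /=; congr (_ + _).
by apply: eq_bigl => i; rewrite negbK.
Qed.

Lemma interior_prodZ c v a : interior_prod v (c *: a) = c *: interior_prod v a.
Proof.
apply/ffunP => K; rewrite !ffunE scaler_sumr; apply: eq_bigr => i _.
by rewrite !ffunE scalerAr.
Qed.

Lemma interior_prodD v a b :
  interior_prod v (a + b) = interior_prod v a + interior_prod v b.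
Proof.
apply/ffunP => K; rewrite !ffunE -big_split; apply: eq_bigr => i _.
by rewrite ffunE mulrDr.
Qed.

Lemma interior_prod0 v : interior_prod v 0 = 0.
Proof. by rewrite -[X in interior_prod v X](scale0r 0) interior_prodZ scale0r. Qed.

(** The successive interior products of [a] with the vectors of [vs], the head
    of [vs] coming first; [eval_ext a vs] is its degree 0 coefficient. *)
Definition interior_prods a (vs : seq 'rV[R]_n) : ext R n :=
  foldl (fun b v => interior_prod v b) a vs.

Lemma interior_prodsZ c a vs : interior_prods (c *: a) vs = c *: interior_prods a vs.
Proof. by elim: vs a => //= v vs IH a; rewrite interior_prodZ IH. Qed.

(** Exterior product with [w] commutes, up to sign, with the interior products
    by vectors orthogonal to [w]. *)
Lemma covector_wedge_interior_prods w a vs : (forall v, v \in vs -> dotp v w = 0) ->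
  covector_wedge w (interior_prods a vs) =
  (-1) ^+ size vs *: interior_prods (covector_wedge w a) vs.
Proof.
elim: vs a => [|v vs IH] a hvs /=; first by rewrite scale1r.
rewrite IH; last by move=> z zvs; apply: hvs; rewrite inE zvs orbT.
have := interior_covector_wedge v w a; rewrite hvs ?mem_head// scale0r.
move=> /eqP; rewrite addr_eq0 => /eqP ->.
rewrite -(scaleN1r (covector_wedge _ _)) interior_prodsZ scalerA exprSr.
by rewrite -mulrA mulrNN !mulr1.
Qed.

Lemma covector_wedge_top w a : homogeneous n a -> covector_wedge w a = 0.
Proof.
move=> ha; apply/ffunP => K; rewrite !ffunE big1// => j jK.
rewrite ha ?mulr0//; apply: contraTneq jK => Kn; apply/negP => jK.
have := max_card (mem K); rewrite card_ord (cardsD1 j) jK -[X in (_ <= X)%N]Kn.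
by rewrite add1n ltnn.
Qed.

(** On vectors orthogonal to the unit vector [w], the form [i_u a], with [a] of
    top degree, depends on [u] through [u . w] only. Indeed [w /\ a = 0], so that
    [w /\ i_u a = (u . w) a]; contracting with [vs] gives the components of
    [(i_u a)(vs) w], and pairing them with [w] gives the formula. *)
Lemma eval_ext_normal w u a vs : homogeneous n a -> dotp w w = 1 ->
  (forall v, v \in vs -> dotp v w = 0) ->
  eval_ext (interior_prod u a) vs =
  (-1) ^+ size vs * dotp u w * \sum_i w 0 i * interior_prods a vs [set i]%SET.
Proof.
move=> ha ww hvs; have := interior_covector_wedge u w a.
rewrite covector_wedge_top// interior_prod0 add0r => cu.
have H i : w 0 i * eval_ext (interior_prod u a) vs =
    (-1) ^+ size vs * dotp u w * interior_prods a vs [set i]%SET.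
  have := covector_wedge_interior_prods (interior_prod u a) hvs.
  rewrite cu interior_prodsZ scalerA => /ffunP/(_ [set i]%SET).
  rewrite !ffunE big_set1 finset.setDv shuffle_sign1 => H; apply: etrans H.
  by rewrite /rank_in eq_card0 ?mul1r// => k; rewrite !inE.
transitivity (dotp w w * eval_ext (interior_prod u a) vs); first by rewrite ww mul1r.
rewrite {1}/dotp mulr_suml mulr_sumr; apply: eq_bigr => i _.
by rewrite -mulrA H mulrCA.
Qed.

End ext_product.

(** * Traces on the boundary *)

Section bounded.
Variables (R : realType) (T : Type) (F : set_system T).
Hypothesis FF : ProperFilter F.
Implicit Types f g : T -> R.

Lemma cvgM0_bounded f g : bounded_near (g : T -> R^o) F ->
  (f : T -> R^o) @ F --> (0 : R^o) ->
  ((fun x => f x * g x) : T -> R^o) @ F --> (0 : R^o).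
Proof.
move=> /ex_bound[M FM] f0.
apply/cvgr0Pnorm_lt => e e0.
have M0 : 0 < `|M| + 1 by rewrite ltr_wpDl.
have /cvgr0Pnorm_lt/(_ (e / (`|M| + 1))) : (f : T -> R^o) @ F --> (0 : R^o) by [].
rewrite divr_gt0// => /(_ isT) Ff.
apply: filterS2 Ff FM => x /= fx gx.
rewrite normrM -[ltRHS](divfK (lt0r_neq0 M0)).
by rewrite ltr_pM// (le_lt_trans gx)// (le_lt_trans (ler_norm _))// ltrDl.
Qed.

Lemma bounded_near_mull (c : R) g : bounded_near (g : T -> R^o) F ->
  bounded_near ((fun x => c * g x) : T -> R^o) F.
Proof.
move=> /ex_bound[M FM]; apply/ex_bound; exists (`|c| * M).
by apply: filterS FM => x /= gx; rewrite normrM ler_wpM2l.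
Qed.

Lemma bounded_near_sum (I : Type) (r : seq I) (P : pred I) (g : I -> T -> R) :
  (forall i, P i -> bounded_near (g i : T -> R^o) F) ->
  bounded_near ((fun x => \sum_(i <- r | P i) g i x) : T -> R^o) F.
Proof.
move=> hg; elim: r => [|i r IH].
  apply/ex_bound; exists 0; apply: filterE => x /=; by rewrite big_nil normr0.
case: (boolP (P i)) => Pi; last first.
  rewrite [X in bounded_near X _](_ : _ = (fun x => \sum_(i <- r | P i) g i x))//.
  by apply/funext => x; rewrite big_cons (negbTE Pi).
have /ex_bound[M FM] := hg i Pi; have /ex_bound[N FN] := IH.
apply/ex_bound; exists (M + N); apply: filterS2 FM FN => x /= gx sx.
by rewrite big_cons Pi (le_trans (ler_normD _ _))// lerD.
Qed.

(** The vectors [vs] are fixed: only the coefficients of the form vary. *)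
Lemma bounded_near_interior_prods n (a : T -> ext R n) (vs : seq 'rV[R]_n) :
  (forall K, bounded_near ((fun x => a x K) : T -> R^o) F) ->
  forall K, bounded_near ((fun x => interior_prods (a x) vs K) : T -> R^o) F.
Proof.
elim: vs a => [|v vs IH] a ha K //=.
apply: (IH (fun x => interior_prod v (a x))) => {}K.
under eq_fun do rewrite ffunE.
apply: bounded_near_sum => i _; exact: bounded_near_mull.
Qed.
End bounded.

Section boundary_traces.
Variables (R : realType) (m : nat).
Local Notation n := m.+1.
Variable Omega : set 'rV[R]_n.
Variables (sigma : {measure set 'rV[R]_n -> \bar R}) (E : 'rV[R]_n -> 'M[R]_n).

Lemma boundary_proper x : boundary Omega x ->
  ProperFilter (within Omega (nbhs x)).
Proof. by move=> [cx _]; exact: within_nbhs_proper. Qed.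

Hypothesis hE : forall x, E x *m (E x)^T = 1%:M.

Lemma frame_rowsE x :
  frame_rows E x = row ord0 (E x) :: [seq row (lift ord0 i) (E x) | i <- enum 'I_m].
Proof. by rewrite /frame_rows enum_ordSl /= -map_comp. Qed.

Lemma dotp_rowE x i j : dotp (row i (E x)) (row j (E x)) = (i == j)%:R.
Proof.
have /matrixP/(_ i j) := hE x; rewrite !mxE => <-.
by apply: eq_bigr => k _; rewrite !mxE.
Qed.

Lemma dotp_normal x : dotp (normal E x) (normal E x) = 1.
Proof. by rewrite /normal frame_rowsE dotp_rowE eqxx. Qed.

Lemma tangent_frame_tangent x v : v \in tangent_frame E x -> tangent_at E x v.
Proof.
rewrite /tangent_frame frame_rowsE /= => /mapP[i _ ->].
by rewrite /tangent_at /normal frame_rowsE /= dotp_rowE eq_sym (negbTE (neq_lift _ _)).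
Qed.

Lemma size_tangent_frame x : size (tangent_frame E x) = m.
Proof. by rewrite /tangent_frame frame_rowsE /= size_map -cardE card_ord. Qed.

(** The interior product of a top form with a tangent field has vanishing trace:
    by [eval_ext_normal] its values on tangent vectors are [u . nu], which tends
    to 0, times coefficients which are bounded near the boundary. The tangential
    part of [u] may be unbounded. *)
Lemma vanishing_trace_intp (u : vfield R n) (alpha : Defs.form R n) :
  admissible_form Omega n alpha -> tangent_field Omega sigma E u ->
  vanishing_trace Omega sigma E m (intp u alpha).
Proof.
move=> [ha _ hb]; apply: filterS => x ux bx vs _ tvs.
have FP := boundary_proper bx.
pose g y : R := (-1) ^+ size vs *
  \sum_i normal E x 0 i * interior_prods (alpha y) vs [set i]%SET.
apply: (@cvg_trans _ ((fun y => dotp (u y) (normal E x) * g y : R^o) @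
    within Omega (nbhs x))).
  apply: near_eq_cvg; near=> y.
  have Oy : Omega y by near: y; exact: withinT.
  rewrite /intp (eval_ext_normal _ (ha y Oy) (dotp_normal x)) /g; last exact: tvs.
  by rewrite mulrA [dotp _ _ * _]mulrC.
apply: cvgM0_bounded (ux bx); apply: bounded_near_mull.
apply: bounded_near_sum => i _; apply: bounded_near_mull.
by apply: bounded_near_interior_prods => K; exact: hb.
Unshelve. all: by end_near. Qed.

Lemma vanishing_trace_has_trace i alpha : 
  vanishing_trace Omega sigma E i alpha -> has_trace Omega sigma E i alpha.
Proof.
apply: filterS => x hx bx vs sv tv.
apply: cvgP; exact: (hx bx vs sv tv).
Qed.

Lemma vanishing_trace_density alpha :
  vanishing_trace Omega sigma E m alpha -> trace_density Omega sigma E alpha (fun=> 0).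
Proof.
apply: filterS => x hx bx; apply/esym.
have FP := boundary_proper bx.
apply: cvg_lim => //; apply: hx => //; first exact: size_tangent_frame.
exact: tangent_frame_tangent.
Qed.
End boundary_traces.

(** * The integral of a discrete Lie derivative *)

Section discrete.
Variables (R : realType) (m : nat).
Local Notation n := m.+1.
Variable Omega : set 'rV[R]_n.
Variables (sigma : {measure set 'rV[R]_n -> \bar R}) (E : 'rV[R]_n -> 'M[R]_n).
Variable D : discretization R n.
Hypothesis hO : stokes_domain Omega sigma E.
Hypothesis h1 : discrete_forms Omega D.
Hypothesis h2 : discrete_projections Omega sigma E D.
Hypothesis hX : discrete_fields Omega sigma E D.

Lemma measurable_domain : measurable Omega.
Proof. exact: (open_measurable_rV (domain_open hO)). Qed.

(** There is no nonzero form of degree n + 1 on an n-dimensional domain. *)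
Lemma form_sp_top0 (a : form_sp D n.+1) : a = 0.
Proof.
apply: (forms_injective h1); apply: aeW => x Ox; apply/ffunP => I.
rewrite (admissible_degree (forms_admissible h1 a) Ox) ?ffunE//.
by apply: contraTneq (max_card (mem I)) => ->; rewrite card_ord ltnn.
Qed.

Lemma form_of_lin i c (a b : form_sp D i) :
  form_of D i (c *: a + b) = c *: form_of D i a + form_of D i b.
Proof. exact: linearP. Qed.

Lemma intp_lin (u : vfield R n) c (alpha beta : Defs.form R n) :
  intp u (c *: alpha + beta) = c *: intp u alpha + intp u beta.
Proof.
apply/funext => x.
rewrite -[RHS]/(c *: interior_prod (u x) (alpha x) +
  interior_prod (u x) (beta x)).
by rewrite -interior_prodZ -interior_prodD.
Qed.

Lemma proj_intp_lin (u : field_sp D) i c (a b : form_sp D i.+1) :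
  proj_form D i (intp (field_of D u) (form_of D i.+1 (c *: a + b))) =
  c *: proj_form D i (intp (field_of D u) (form_of D i.+1 a)) +
  proj_form D i (intp (field_of D u) (form_of D i.+1 b)).
Proof.
by rewrite form_of_lin intp_lin (proj_linear h2)//; exact: (proj_dom_intp h2).
Qed.

Lemma lie_fun_top (u : field_sp D) (a : form_sp D n) :
  lie_fun u a = extd D m (proj_form D m (intp (field_of D u) (form_of D n a))).
Proof.
rewrite /= [X in _ + X](_ : _ = 0) ?addr0// (form_sp_top0 (extd D m.+1 a)).
(* Linearity at 0 = (-1) 0 + 0 shows that i_u 0 projects to 0. *)
have := proj_intp_lin u (-1) (0 : form_sp D n.+1) 0.
by rewrite scaler0 addr0 scaleN1r addNr.
Qed.

(** On forms of top degree the discrete Lie derivative is [d Pi (i_u a)]. *)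
Lemma lie_top (u : field_sp D) (a : form_sp D n) :
  lie u n a = extd D m (proj_form D m (intp (field_of D u) (form_of D n a))).
Proof.
have lin : linear (lie_fun u (i := n)).
  by move=> c x y; rewrite !lie_fun_top proj_intp_lin linearP.
pose L := GRing.isLinear.Build _ _ _ _ (lie_fun u (i := n)) lin.
pose f : {linear form_sp D n -> form_sp D n} := HB.pack (lie_fun u (i := n)) L.
by rewrite -lie_fun_top /lie -[RHS]/(f a) -(lfunE f).
Qed.

Lemma form_integrable i (a : form_sp D i) I :
  (lebesgue_rV R n).-integrable Omega (EFin \o (fun x => form_of D i a x I)).
Proof. exact: (admissible_integrable (forms_admissible h1 a)). Qed.

(** Stokes' theorem, with zero boundary term: the projection keeps the trace of
    [i_u a] zero. *)
Lemma integral_extd_proj (u : field_sp D) (a : form_sp D n) :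
  integral_form Omega (form_of D n
    (extd D m (proj_form D m (intp (field_of D u) (form_of D n a))))) = 0.
Proof.
set b := proj_form D m _.
have vb : vanishing_trace Omega sigma E m (form_of D m b).
  apply: (proj_trace h2); first exact: (proj_dom_intp h2).
  apply: (vanishing_trace_intp (frame_orthonormal hO)).
    exact: (forms_admissible h1).
  exact: (fields_tangent hX).
rewrite (stokes hO (alpha := form_of D m b) (g := fun=> 0)).
- by rewrite /Rintegral integral0.
- exact: (forms_admissible h1).
- exact: (admissible_degree (forms_admissible h1 _)).
- exact: form_integrable.
- exact: (forms_extd h1).
- exact: vanishing_trace_has_trace.
- exact: (vanishing_trace_density (frame_orthonormal hO)).
- exact: integrable0.
Qed.

Lemma integral_lie (u : field_sp D) (a : form_sp D n) :
  integral_form Omega (form_of D n (lie u n a)) = 0.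
Proof. by rewrite lie_top integral_extd_proj. Qed.

Lemma integral_form_lin c (a b : form_sp D n) :
  integral_form Omega (form_of D n (c *: a + b)) =
  c * integral_form Omega (form_of D n a) + integral_form Omega (form_of D n b).
Proof.
have mO := measurable_domain.
rewrite /integral_form /density -RintegralZl//; last exact: form_integrable.
rewrite -RintegralD//; last exact: form_integrable.
  by apply: eq_Rintegral => x _; rewrite form_of_lin /= !ffunE.
exact: (integrableZl mO c (form_integrable a _)).
Qed.

End discrete.

(** * Linear functionals along curves *)

Section curves.
Variables (R : realType) (W : vectType R).
Implicit Types (l : {linear W -> R^o}) (c : R -> W) (J : set R).

Lemma linear_curveE l c t :
  l (c t) = \sum_i curve_coord c i t * l (vbasis fullv)`_i.
Proof.
rewrite {1}(coord_vbasis (memvf (c t))) linear_sum.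
by apply: eq_bigr => i _; rewrite linearZ.
Qed.

Lemma itv_interior J a b : is_interval J -> J a -> J b ->
  `]a, b[ `<=` J^°.
Proof.
move=> iJ Ja Jb x xab.
have : `]a, b[%classic `<=` J.
  move=> y /=; rewrite in_itv /= => /andP[ay yb].
  by apply: (iJ a b) => //; rewrite (ltW ay) (ltW yb).
move=> /interiorS; apply.
by have /interior_id -> := @interval_open R (BRight a) (BLeft b) isT isT.
Qed.

Lemma within_continuous_sum J (I : Type) (r : seq I) (f : I -> R -> R) :
  (forall i, {within J, continuous (f i)}) ->
  {within J, continuous (fun t => \sum_(i <- r) f i t)}.
Proof.
move=> cf x; elim: r => [|i r IH].
  under eq_fun do rewrite big_nil. exact: cvg_cst.
under eq_fun do rewrite big_cons.
by apply: cvgD => //; exact: cf.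
Qed.

Lemma is_derive_linear_curve l J c t : smooth_curve J c -> J^° t ->
  is_derive t 1 (fun s => l (c s) : R) (l (dtime c t)).
Proof.
move=> sc Jt.
have -> : (fun s => l (c s) : R) =
    \sum_i (fun s => curve_coord c i s * l (vbasis fullv)`_i).
  by apply/funext => s; rewrite linear_curveE fct_sumE.
have -> : l (dtime c t) =
    \sum_i derive1 (curve_coord c i : R -> R^o) t * l (vbasis fullv)`_i.
  by rewrite /dtime linear_sum; apply: eq_bigr => i _; rewrite linearZ.
apply: is_derive_sum => i.
have [_ /(_ [::] _ Jt)[_ /(_ 1) di]] := sc i.
have dc : is_derive t 1 (curve_coord c i : R -> R^o)
    (derive1 (curve_coord c i : R -> R^o) t).
  by rewrite derive1E; exact: derivableP.
rewrite mulrC [X in is_derive _ _ X _](_ : _ =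
    l (vbasis fullv)`_i \*: (curve_coord c i : R -> R^o)).
  exact: is_deriveZ.
by apply/funext => s; rewrite mulrC.
Qed.

(** A linear functional that vanishes on the velocity of a curve in the interior
    of an interval is constant along the curve, by the mean value theorem. *)
Lemma linear_curve_cst l J c : is_interval J -> smooth_curve J c ->
  (forall t, J^° t -> l (dtime c t) = 0) ->
  forall t1 t2, J t1 -> J t2 -> l (c t1) = l (c t2).
Proof.
move=> iJ sc l0 t1 t2.
wlog t12 : t1 t2 / t1 < t2 => [H J1 J2|J1 J2].
  by case: (ltgtP t1 t2) => [t12|t21|-> //]; [exact: H|apply/esym; exact: H].
have [x||s _ /eqP] := @MVT R (fun s => l (c s)) (fun=> 0) t1 t2 t12.
- move=> xt; have Jx := itv_interior iJ J1 J2 xt.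
  by rewrite -(l0 _ Jx); exact: is_derive_linear_curve.
- apply: (continuous_subspaceW (B := J)).
    by move=> y /=; rewrite in_itv /= => /andP[? ?]; apply: (iJ t1 t2) => //; apply/andP.
  under eq_fun do rewrite linear_curveE.
  apply: within_continuous_sum => i x; apply: cvgMl; exact: (sc i).1.
- by rewrite mul0r subr_eq0 => /eqP.
Qed.
End curves.

(** * Conservation of entropy *)

Theorem proposition5 (R : realType) (n : nat) (hn : n = 2%N \/ n = 3%N)
    (Omega : set 'rV[R]_n)
    (sigma : {measure set 'rV[R]_n -> \bar R}) (E : 'rV[R]_n -> 'M[R]_n)
    (hOmega : stokes_domain Omega sigma E)
    (D : discretization R n)
    (h1 : discrete_forms Omega D) (h2 : discrete_projections Omega sigma E D)
    (hX : discrete_fields Omega sigma E D) (h3 : lie_left_inverse D)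
    (De : set (R^o * R^o)) (e : R^o * R^o -> R^o)
    (hDe : open De) (he : smooth_on De e)
    (J : set R) (hJ : is_interval J)
    (u : R -> field_sp D) (rho sig : R -> form_sp D n)
    (beta : R -> form_sp D n.-1)
    (hS : scheme_solution Omega De e u rho sig beta J) :
  forall t1 t2, J t1 -> J t2 ->
    integral_form Omega (form_of D n (sig t1)) =
    integral_form Omega (form_of D n (sig t2)).
Proof.
(* The dimension is a successor, since Stokes' theorem involves (n-1)-forms. *)
case: n hn Omega sigma E hOmega D h1 h2 hX h3 u rho sig beta hS => [|m] hn.
  by case: hn.
move=> Omega sigma E hOmega D h1 h2 hX _ u rho sig beta hS.
pose integral (a : form_sp D m.+1) : R^o := integral_form Omega (form_of D m.+1 a).
have integral_linear : linear integral.
  by move=> c a b; exact: (integral_form_lin hOmega h1).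
pose L := GRing.isLinear.Build _ _ _ _ integral integral_linear.
pose l : {linear form_sp D m.+1 -> R^o} := HB.pack integral L.
apply: (linear_curve_cst (l := l) hJ (smooth_sig hS)) => t Jt.
have /eqP := transport_sig hS Jt.
rewrite addr_eq0 => /eqP ->; rewrite linearN.
by rewrite [X in - X](integral_lie hOmega h1 h2 hX) oppr0.
Qed.
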